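(* Let $A$ be a set and let $H$ be a finitely generated subgroup of the free group $F_A$ on $A$. Let $\mathbf{Ab}$ be the pseudovariety of all finite abelian groups and, for a positive integer $m$, let $\mathbf{Ab}(m)$ be the pseudovariety of all finite abelian groups of exponent dividing $m$. Then: (i) $H$ is $\mathbf{Ab}$-clopen if and only if there exist $r\geq 1$, primes $p_1,\dots,p_r$, positive integers $k_1,\dots,k_r$ and $\mathbf{Ab}(p_i^{k_i})$-clopen subgroups $H_i$ of $F_A$ for $1\leq i\leq r$ such that $H=\bigcap_{i=1}^r H_i$; (ii) $H$ is $\mathbf{Ab}$-dense if and only if $H$ is $\mathbf{Ab}(p)$-dense for every prime $p$; (iii) $$\mathrm{Cl}_{\mathbf{Ab}}(H)=\bigcap_{p\in\mathbb{P}}\bigcap_{k\in\mathbb{N}}\mathrm{Cl}_{\mathbf{Ab}(p^k)}(H)=\bigcap_{p\in\mathbb{P}}\bigcap_{k\in\mathbb{N}}HF_A'F_A^{p^k}.$$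
   Context: $\mathbb{P}$ is the set of all primes, and $k$ ranges over the positive integers. $F_A'=[F_A,F_A]$ is the derived subgroup of $F_A$ and $F_A^m=\langle u^m\mid u\in F_A\rangle$ is the subgroup generated by all $m$-th powers. A pseudovariety (of finite groups) is a class of finite groups closed under taking subgroups, homomorphic images and finitary direct products. For a pseudovariety $\mathbf{V}$, the pro-$\mathbf{V}$ topology on a group $G$ is the coarsest topology making all homomorphisms from $G$ to elements of $\mathbf{V}$ (with the discrete topology) continuous; equivalently, the normal subgroups $K$ of $G$ with $G/K\in\mathbf{V}$ form a basis of neighbourhoods of the identity. $\mathrm{Cl}_{\mathbf{V}}(H)$ denotes the closure of $H$ in the pro-$\mathbf{V}$ topology on $F_A$. A subgroup is $\mathbf{V}$-clopen (respectively $\mathbf{V}$-dense) if it is both closed and open (respectively dense) in the pro-$\mathbf{V}$ topology on $F_A$. *)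

(* Defs.v *)
From HB Require Import structures.
From mathcomp Require Import all_boot all_fingroup all_solvable.
From mathcomp Require Import all_classical topology.

Set Implicit Arguments.
Unset Strict Implicit.
Unset Printing Implicit Defensive.

Local Open Scope group_scope.
Local Open Scope classical_set_scope.

Section FreeGroup.
Variable A : Type.

(* The letter (a, false) stands for the generator a, and (a, true) for its
   inverse. [{classic A}] is A with classically decidable equality. *)
Definition letter : choiceType := ({classic A} * bool)%type.

Definition inv_letter (x : letter) : letter := (x.1, ~~ x.2).

Definition reduced (w : seq letter) : bool :=
  sorted (fun x y => y != inv_letter x) w.

Definition push (x : letter) (w : seq letter) : seq letter :=
  if w is y :: w' then if y == inv_letter x then w' else x :: w else [:: x].

Definition reduce (w : seq letter) : seq letter := foldr push [::] w.

Lemma inv_letterK : involutive inv_letter.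
Proof. by case=> a b; rewrite /inv_letter /= negbK. Qed.

Lemma push_reduced x w : reduced w -> reduced (push x w).
Proof.
case: w => [|y w] //= yw; case: ifPn => [_|xy]; first exact: path_sorted yw.
by rewrite /reduced /= xy.
Qed.

Lemma foldr_push_reduced u w : reduced w -> reduced (foldr push w u).
Proof. by move=> rw; elim: u => //= x u; exact: push_reduced. Qed.

Lemma reduce_reduced w : reduced (reduce w).
Proof. exact: foldr_push_reduced. Qed.

Lemma pushK x w : reduced w -> push (inv_letter x) (push x w) = w.
Proof.
case: w => [|y w] /= rw; first by rewrite inv_letterK eqxx.
case: eqVneq => [yE|_] /=; last by rewrite inv_letterK eqxx.
case: w rw => [|z w] /=; first by rewrite yE.
by case/andP; rewrite yE inv_letterK => /negbTE ->.
Qed.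

Lemma foldr_push_push x u w : reduced w ->
  foldr push w (push x u) = push x (foldr push w u).
Proof.
move=> rw; case: u => [|y u] //=; case: eqVneq => [->|//].
have := @pushK (inv_letter x) _ (foldr_push_reduced u rw).
by rewrite inv_letterK.
Qed.

Lemma foldr_push_reduce u w : reduced w ->
  foldr push w (reduce u) = foldr push w u.
Proof. by move=> rw; elim: u => //= x u IH; rewrite foldr_push_push // IH. Qed.

Lemma reduce_id w : reduced w -> reduce w = w.
Proof.
elim: w => //= x w IH xw; have rw : reduced w := path_sorted xw.
by rewrite IH //; case: w xw {rw IH} => //= y w /andP[/negbTE ->].
Qed.

Lemma reduce_cat u v : reduce (u ++ v) = foldr push (reduce v) u.
Proof. by rewrite /reduce foldr_cat. Qed.

Definition inv_word (w : seq letter) : seq letter := rev (map inv_letter w).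

Lemma inv_wordK : involutive inv_word.
Proof.
by move=> w; rewrite /inv_word map_rev revK (mapK inv_letterK).
Qed.

Lemma inv_word_reduced w : reduced w -> reduced (inv_word w).
Proof.
move=> rw; rewrite /reduced /inv_word rev_sorted sorted_map.
apply: sub_sorted rw => x y /=.
by rewrite (inj_eq (inv_inj inv_letterK)); apply: contraNneq => ->; rewrite inv_letterK.
Qed.

Lemma reduce_mulV w : reduce (inv_word w ++ w) = [::].
Proof.
elim: w => //= x w IH; rewrite /inv_word /= rev_cons -cats1 -catA reduce_cat /=.
by rewrite -/(reduce w) pushK ?reduce_reduced // -reduce_cat.
Qed.

Definition free_group : Type := {w : seq letter | reduced w}.
HB.instance Definition _ := Choice.on free_group.
Implicit Types u v w : free_group.

Definition free_one : free_group := exist _ [::] isT.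
Definition free_mul u v : free_group :=
  exist _ (reduce (val u ++ val v)) (reduce_reduced _).
Definition free_inv u : free_group :=
  exist _ (inv_word (val u)) (inv_word_reduced (valP u)).

Lemma free_mulA : associative free_mul.
Proof.
move=> u v w; apply: val_inj; rewrite /= [LHS]reduce_cat [RHS]reduce_cat.
rewrite (reduce_id (reduce_reduced _)) reduce_cat.
by rewrite foldr_push_reduce ?reduce_reduced // foldr_cat.
Qed.

Lemma free_1mul : left_id free_one free_mul.
Proof. by move=> u; apply: val_inj; rewrite /= reduce_id ?(valP u). Qed.

Lemma free_mul1 : right_id free_one free_mul.
Proof. by move=> u; apply: val_inj; rewrite /= cats0 reduce_id ?(valP u). Qed.

Lemma free_mulV : left_inverse free_one free_inv free_mul.
Proof. by move=> u; apply: val_inj; rewrite /= reduce_mulV. Qed.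

Lemma free_Vmul : right_inverse free_one free_inv free_mul.
Proof.
by move=> u; apply: val_inj; rewrite /= -{1}(inv_wordK (val u)) reduce_mulV.
Qed.

HB.instance Definition _ := isGroup.Build free_group
  free_mulA free_1mul free_mul1 free_mulV free_Vmul.

End FreeGroup.

Section Subgroups.
Variable G : groupType.
Implicit Types (H S T : set G) (m : nat).

Definition is_subgroup H : Prop :=
  [/\ H 1, forall x y, H x -> H y -> H (x * y) & forall x, H x -> H x^-1].

Definition generated S : set G := smallest is_subgroup S.

Definition finitely_generated H : Prop :=
  exists s : seq G, H = generated [set` s].

Definition derived_subgroup : set G :=
  generated [set z | exists x y : G, z = [~ x, y]].

Definition power_subgroup m : set G := generated [set u ^+ m | u in [set: G]].

Definition mulset S T : set G := [set x * y | x in S & y in T].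

End Subgroups.

Arguments derived_subgroup G : clear implicits.
Arguments power_subgroup G m : clear implicits.

Record pseudovariety := Pseudovariety {
  pv_class :> finGroupType -> Prop;
  pv_subgroup : forall (gT : finGroupType) (K : {group gT}),
    pv_class gT -> pv_class [the finGroupType of subg_of K];
  pv_image : forall (gT rT : finGroupType) (f : {multiplicative gT -> rT}),
    (forall y, exists x, f x = y) -> pv_class gT -> pv_class rT;
  pv_product : forall (I : finType) (gT : I -> finGroupType),
    (forall i, pv_class (gT i)) ->
    pv_class [the finGroupType of {dffun forall i, gT i}]
}.

Definition Ab_class (gT : finGroupType) : Prop := abelian [set: gT]%SET.

Definition Abm_class (m : nat) (gT : finGroupType) : Prop :=
  abelian [set: gT]%SET /\ (exponent [set: gT]%SET %| m)%N.

Section AbelianClasses.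

Lemma Ab_classP (gT : finGroupType) :
  Ab_class gT <-> forall x y : gT, x * y = y * x.
Proof.
split=> [/centsP ab x y|ab]; first by apply: ab; rewrite inE.
by apply/centsP => x _ y _; exact: ab.
Qed.

Lemma exponent_setT_dvdn (gT : finGroupType) m :
  (exponent [set: gT]%SET %| m)%N <-> forall x : gT, x ^+ m = 1.
Proof.
split=> [/exponentP e x|e]; first by apply: e; rewrite inE.
by apply/exponentP => x _; exact: e.
Qed.

Lemma Ab_subgroup (gT : finGroupType) (K : {group gT}) :
  Ab_class gT -> Ab_class [the finGroupType of subg_of K].
Proof.
by move=> /Ab_classP ab; apply/Ab_classP => x y; apply: val_inj => /=; exact: ab.
Qed.

Lemma Ab_image (gT rT : finGroupType) (f : {multiplicative gT -> rT}) :
  (forall y, exists x, f x = y) -> Ab_class gT -> Ab_class rT.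
Proof.
move=> surj /Ab_classP ab; apply/Ab_classP => x y.
by have [[x' <-] [y' <-]] := (surj x, surj y); rewrite -!gmulfM ab.
Qed.

Lemma Ab_product (I : finType) (gT : I -> finGroupType) :
  (forall i, Ab_class (gT i)) ->
  Ab_class [the finGroupType of {dffun forall i, gT i}].
Proof.
move=> ab; apply/Ab_classP => x y; apply/ffunP => i.
by rewrite !mulg_ffun; have /Ab_classP := ab i; apply.
Qed.

Lemma Abm_subgroup m (gT : finGroupType) (K : {group gT}) :
  Abm_class m gT -> Abm_class m [the finGroupType of subg_of K].
Proof.
case=> ab /exponent_setT_dvdn e; split; first exact: Ab_subgroup.
apply/exponent_setT_dvdn => x; apply: val_inj => /=.
have valX n : sgval (x ^+ n) = sgval x ^+ n.
  by elim: n => // n IH; rewrite !expgS /= -IH.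
by rewrite valX e.
Qed.

Lemma Abm_image m (gT rT : finGroupType) (f : {multiplicative gT -> rT}) :
  (forall y, exists x, f x = y) -> Abm_class m gT -> Abm_class m rT.
Proof.
move=> surj [ab /exponent_setT_dvdn e]; split; first exact: Ab_image surj ab.
have f1 : f 1 = 1 by apply: (mulgI (f 1)); rewrite -gmulfM !mulg1.
have fX x n : f (x ^+ n) = f x ^+ n.
  by elim: n => // n IH; rewrite !expgS gmulfM IH.
by apply/exponent_setT_dvdn => y; have [x <-] := surj y; rewrite -fX e f1.
Qed.

Lemma Abm_product m (I : finType) (gT : I -> finGroupType) :
  (forall i, Abm_class m (gT i)) ->
  Abm_class m [the finGroupType of {dffun forall i, gT i}].
Proof.
move=> abm; split; first by apply: Ab_product => i; have [] := abm i.
apply/exponent_setT_dvdn => x; apply/ffunP => i; rewrite oneg_ffun.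
have ffunX n : (x ^+ n) i = x i ^+ n.
  by elim: n => [|n IH]; rewrite ?oneg_ffun // !expgS mulg_ffun IH.
by rewrite ffunX; have [_ /exponent_setT_dvdn] := abm i; apply.
Qed.

End AbelianClasses.

Definition Ab : pseudovariety := Pseudovariety Ab_subgroup Ab_image Ab_product.

Definition Abm (m : nat) : pseudovariety :=
  Pseudovariety (@Abm_subgroup m) (@Abm_image m) (@Abm_product m).

(* A copy of G carrying the pro-V topology: the coarsest topology for which
   every homomorphism from G to a discrete member of V is continuous. *)
Definition pro_topology (V : pseudovariety) (G : groupType) : Type := G.

Section ProTopology.
Variables (V : pseudovariety) (G : groupType).

Definition pro_subbase : set (set G) :=
  [set S | exists (gT : finGroupType) (f : {multiplicative G -> gT})
             (U : set gT), V gT /\ S = f @^-1` U].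

HB.instance Definition _ := Choice.on (pro_topology V G).
HB.instance Definition _ :=
  isSubBaseTopological.Build (pro_topology V G) pro_subbase id.

Definition pro_clopen (H : set G) : Prop := @clopen (pro_topology V G) H.
Definition pro_dense (H : set G) : Prop := @dense (pro_topology V G) H.
Definition pro_closure (H : set G) : set G := @closure (pro_topology V G) H.

End ProTopology.

(* Main.v *)
Require Import Defs.
From HB Require Import structures.
From mathcomp Require Import all_boot all_fingroup all_solvable.
From mathcomp Require Import all_classical topology.
From mathcomp Require Import finalg zmodp finmap.

(** The topological notions first become statements about homomorphisms to
members of V: x lies in the closure of H when f x lies in the image of H for
every such f ([pro_closureP]), H is dense when its closure is everything, and
a subgroup is clopen when it contains a kernel ([pro_clopen_subgroupP]).  A
finite group carrying several homomorphisms at once exists because V is closed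
under finite products ([joint_hom]).

The passage from Ab to prime powers is the primary decomposition.  In a finite
abelian group of exponent n, the map raising elements to the power n_(p'), the
largest divisor of n prime to p, is up to an automorphism the projection onto
the p-component.  An element whose images under all these maps lie in a
subgroup B lies in B itself ([primary_separation]), and the image of each map
has exponent dividing p^(v_p(n)).  This gives the first equality of (iii), and
(i) by taking a homomorphism f whose kernel lies in H, B the image of H under
f, and for the i-th clopen subgroup the preimage of B under f followed by the
i-th of these maps.  For (ii), a proper subgroup of a finite abelian group lies
in one of prime index, and the quotient by the latter belongs to Ab(p)
([prime_separation]).

There remains the equality of the Ab(m)-closure of H with H F' F^m for m > 1
([pro_closure_AbmE]).  For infinite A the subgroup H F' F^m may have infinite
index, so it need not be open.  But x and the generators of H involve only
finitely many letters, and the exponent sums modulo m of these letters form a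
single homomorphism to a group in Ab(m).  If x is in the closure, some h in H
has the same exponent sums as x, so that all exponent sums of h^-1 x vanish
modulo m; as a word is congruent modulo F' F^m to the product of the powers of
its letters with these exponents, h^-1 x lies in F' F^m. *)

Set Implicit Arguments.
Unset Strict Implicit.
Unset Printing Implicit Defensive.

Local Open Scope classical_set_scope.
Local Open Scope group_scope.

(** * Homomorphisms to members of a pseudovariety *)

Definition hom_of (G H : groupType) (g : G -> H)
    (gM : {morph g : x y / x * y}) : {multiplicative G -> H} :=
  HB.pack_for {multiplicative G -> H} g (isMultiplicative.Build G H g gM).

Section HomTheory.
Variables (G H : groupType) (f : {multiplicative G -> H}).

Lemma hom1 : f 1 = 1.
Proof. by apply: (mulgI (f 1)); rewrite -gmulfM !mulg1. Qed.

Lemma homV x : f x^-1 = (f x)^-1.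
Proof. by apply: (mulgI (f x)); rewrite -gmulfM !mulgV hom1. Qed.

Lemma homX x n : f (x ^+ n) = f x ^+ n.
Proof. by elim: n => [|n IH]; rewrite ?hom1 // !expgS gmulfM IH. Qed.

End HomTheory.

(** Finitely many homomorphisms to members of V factor through one, namely
their product. *)
Lemma joint_hom (V : pseudovariety) (G : groupType) (I : finType)
    (gT : I -> finGroupType) (f : forall i, {multiplicative G -> gT i}) :
  (forall i, V (gT i)) ->
  exists (rT : finGroupType) (g : {multiplicative G -> rT}),
    V rT /\ forall x y, g x = g y -> forall i, f i x = f i y.
Proof.
move=> Vg; pose rT : finGroupType := [the finGroupType of {dffun forall i, gT i}].
pose g x : rT := [ffun i => f i x].
have gM : {morph g : x y / x * y}.
  by move=> x y; apply/ffunP => i; rewrite mulg_ffun !ffunE gmulfM.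
exists rT, (hom_of gM); split; first exact: pv_product.
by move=> x y /ffunP e i; have := e i; rewrite !ffunE.
Qed.

(** * The pro-V topology in terms of homomorphisms *)

Section Pro.
Variables (V : pseudovariety) (G : groupType).

Lemma open_fiber (gT : finGroupType) (f : {multiplicative G -> gT}) x :
  V gT -> @open (pro_topology V G) [set y | f y = f x].
Proof.
move=> Vg.
exists [set [set y | f y = f x]]; last by rewrite bigcup_set1.
move=> _ ->; apply: finI_from1.
by exists gT, f, [set f x].
Qed.

(** A basic open set is a finite intersection of preimages, which the product
of the homomorphisms involved turns into a union of fibres of one of them. *)
Lemma finI_pro_subbase (B : set G) x : finI_from (@pro_subbase V G) id B -> B x ->
  exists (gT : finGroupType) (f : {multiplicative G -> gT}),
    V gT /\ forall y, f y = f x -> B y.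
Proof.
move=> [F FS <-] xF.
have : forall S : F, exists h : {gT : finGroupType & {multiplicative G -> gT}},
    V (tag h) /\ forall y, tagged h y = tagged h x -> (val S : set G) y.
  move=> S; have [gT [f [U [Vg SE]]]] := set_mem (FS _ (valP S)).
  exists (existT (fun gT : finGroupType => {multiplicative G -> gT}) gT f).
  split=> //= y e; rewrite SE /= e.
  by have := xF _ (valP S); rewrite /= SE.
case/choice => h hP.
have [rT [g [Vr gP]]] :=
  joint_hom (fun S : F => tagged (h S)) (fun S => (hP S).1).
by exists rT, g; split=> // y e S SF; apply: (hP (FSetSub SF)).2; exact: gP.
Qed.

Lemma pro_openP (U : set G) :
  @open (pro_topology V G) U <->
  forall x, U x -> exists (gT : finGroupType) (f : {multiplicative G -> gT}),
    V gT /\ forall y, f y = f x -> U y.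
Proof.
split=> [[D DB <-] x [B DB0 xB]|UP].
  have [gT [f [Vg fB]]] := finI_pro_subbase (DB _ DB0) xB.
  by exists gT, f; split=> // y e; exists B => //; exact: fB.
rewrite openE => x /UP[gT [f [Vg fU]]].
rewrite /interior nbhsE /=; exists [set y | f y = f x] => //.
by split=> //; exact: open_fiber.
Qed.

Lemma pro_closureP (H : set G) x : pro_closure V H x <->
  forall (gT : finGroupType) (f : {multiplicative G -> gT}), V gT ->
    exists2 h, H h & f h = f x.
Proof.
split=> [cHx gT f Vg|HP B].
  have [|h [Hh fh]] := cHx [set y | f y = f x]; last by exists h.
  by apply: open_nbhs_nbhs; split=> //; exact: open_fiber.
rewrite nbhsE => -[U [/pro_openP oU Ux] UB].
have [gT [f [Vg fU]]] := oU x Ux; have [h Hh fh] := HP gT f Vg.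
by exists h; split=> //; apply/UB/fU.
Qed.

Lemma pro_denseP (H : set G) : pro_dense V H <-> forall x, pro_closure V H x.
Proof.
rewrite /pro_dense /pro_closure; split=> [dH x B|cH U [x Ux] oU].
  rewrite nbhsE => -[U [oU Ux] UB].
  have [|h [Uh Hh]] := dH U _ oU; first by exists x.
  by exists h; split=> //; exact: UB.
have [|h [Hh Uh]] := cH x U; first by apply: open_nbhs_nbhs.
by exists h.
Qed.

(** A subgroup containing a kernel is a union of fibres, hence open; it is
closed as well because a point of its closure shares a fibre with one of its
elements. *)
Lemma pro_clopen_subgroupP (H : set G) : is_subgroup H ->
  pro_clopen V H <->
  exists (gT : finGroupType) (f : {multiplicative G -> gT}),
    V gT /\ forall x, f x = 1 -> H x.
Proof.
case=> H1 HM HV; split=> [[/pro_openP oH _]|[gT [f [Vg fH]]]].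
  have [gT [f [Vg fH]]] := oH 1 H1; exists gT, f; split=> // x fx.
  by apply: fH; rewrite fx hom1.
have sat x y : H x -> f y = f x -> H y.
  move=> Hx e; rewrite -(mulVKg x y); apply: HM => //; apply: fH.
  by rewrite gmulfM homV e mulVg.
split; first by apply/pro_openP => x Hx; exists gT, f; split=> // y; exact: sat.
by move=> x /pro_closureP/(_ gT f Vg)[h Hh e]; apply: (sat h).
Qed.

End Pro.

Lemma pro_closure_sub (V W : pseudovariety) (G : groupType) (H : set G) :
  (forall gT, V gT -> W gT) -> pro_closure W H `<=` pro_closure V H.
Proof.
by move=> VW x /pro_closureP cW; apply/pro_closureP => gT f /VW; exact: cW.
Qed.

(** * Separation in finite abelian groups *)

Lemma image_is_group (G : groupType) (gT : finGroupType)
    (f : {multiplicative G -> gT}) (H : set G) : is_subgroup H ->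
  exists B : {group gT}, forall y, y \in B <-> exists2 x, H x & f x = y.
Proof.
case=> H1 HM HV.
have gB : group_set [set y in [pred y | `[< exists2 x, H x & f x = y >]]]%SET.
  apply/group_setP; split=> [|x y]; rewrite !inE.
    by apply/asboolP; exists 1; rewrite ?hom1.
  move=> /asboolP[u Hu <-] /asboolP[v Hv <-]; apply/asboolP.
  by exists (u * v); [exact: HM|rewrite gmulfM].
by exists (Group gB) => y; rewrite !inE; split=> /asboolP.
Qed.

Lemma is_subgroupT (G : groupType) : is_subgroup [set: G].
Proof. by []. Qed.

(** Membership in Ab(m) constrains the whole target, whereas only the image of
f is known to be abelian of exponent dividing m; the target is therefore cut
down to that image. *)
Lemma Abm_corestrict m (G : groupType) (gT : finGroupType)
    (f : {multiplicative G -> gT}) :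
  (forall x y, f x * f y = f y * f x) -> (forall x, f x ^+ m = 1) ->
  exists (rT : finGroupType) (g : {multiplicative G -> rT}),
    Abm m rT /\ forall x y, g x = g y <-> f x = f y.
Proof.
move=> fC fm; have [K KP] := image_is_group f (is_subgroupT G).
have fK x : f x \in K by apply/KP; exists x.
pose rT : finGroupType := [the finGroupType of subg_of K].
have sgE x : sgval (subg K (f x)) = f x by rewrite subgK.
have gM : {morph (fun x => subg K (f x) : rT) : x y / x * y}.
  by move=> x y; rewrite gmulfM; apply: val_inj; rewrite /= !subgK ?groupM.
exists rT, (hom_of gM); split; last first.
  by move=> x y /=; split=> [e|->//]; rewrite -sgE e sgE.
have sgX (u : rT) n : sgval (u ^+ n) = sgval u ^+ n.
  by elim: n => // n IH; rewrite !expgS /= -IH.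
split.
  apply/Ab_classP => u v; apply: val_inj => /=.
  have [/KP[x _ <-] /KP[y _ <-]] := (subgP u, subgP v).
  exact: fC.
apply/exponent_setT_dvdn => u; apply: val_inj; rewrite /= sgX.
by have /KP[x _ <-] := subgP u; exact: fm.
Qed.

(** When m is the p-part of the exponent and c its p'-part, this is the
projection onto the p-component. *)
Lemma Abm_power_hom (G : groupType) (gT : finGroupType)
    (f : {multiplicative G -> gT}) (c m : nat) :
  Ab gT -> (forall y : gT, y ^+ (c * m)%N = 1) ->
  exists (rT : finGroupType) (g : {multiplicative G -> rT}),
    Abm m rT /\ forall x y, g x = g y <-> f x ^+ c = f y ^+ c.
Proof.
move=> /Ab_classP gC cm.
have gM : {morph (fun x => f x ^+ c) : x y / x * y}.
  by move=> x y; rewrite gmulfM expgMn //; exact: gC.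
have [x y|x|rT [g [Vr gP]]] := @Abm_corestrict m _ _ (hom_of gM).
- exact: gC.
- by rewrite /= -expgM.
- by exists rT, g; split.
Qed.

(** The image of y modulo B is nontrivial, so some prime p divides its order;
raising it to a power prime to p cannot kill it. *)
Lemma primary_separation (gT : finGroupType) (B : {group gT}) (y : gT) n :
  Ab gT -> (0 < n)%N -> y ^+ n = 1 -> y \notin B ->
  exists2 p, p \in primes n & y ^+ n`_p^'%N \notin B.
Proof.
move=> ab n_gt0 yn yB.
have nBT : [set: gT]%SET \subset 'N(B).
  by apply: sub_abelian_norm; [exact: ab|exact: finset.subsetT].
have nB z : z \in 'N(B) by apply: (fintype.subsetP nBT); rewrite inE.
have yB1 : coset B y != 1 by apply: contraNneq yB; exact: coset_idr.
have o_n : (#[coset B y] %| n)%N by rewrite order_dvdn -morphX ?yn ?morph1.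
pose p := pdiv #[coset B y].
have p_pr : prime p by rewrite pdiv_prime // order_gt1.
have p_n : (p %| n)%N := dvdn_trans (pdiv_dvd _) o_n.
exists p; first by rewrite mem_primes p_pr n_gt0.
apply/negP => yc.
have : (p %| n`_p^')%N.
  apply: dvdn_trans (pdiv_dvd _) _; rewrite order_dvdn -morphX //=.
  by apply/eqP; exact: coset_id.
by apply/negP; rewrite -p'natE // part_pnat.
Qed.

Lemma coset_hom (G : groupType) (gT : finGroupType) (f : {multiplicative G -> gT})
    (B : {group gT}) : (forall x, f x \in 'N(B)) ->
  {morph (fun x => coset B (f x)) : x y / x * y}.
Proof. by move=> fN x y; rewrite gmulfM morphM. Qed.

(** The quotient of the image of f by its intersection with B is a nontrivial
finite abelian group, hence has a subgroup of prime index p; g is the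
projection onto the quotient of order p. *)
Lemma prime_separation (G : groupType) (gT : finGroupType)
    (f : {multiplicative G -> gT}) (B : {group gT}) x :
  Ab gT -> f x \notin B ->
  exists (p : nat) (rT : finGroupType) (g : {multiplicative G -> rT}),
    [/\ prime p, Abm p rT, forall y, f y \in B -> g y = 1 & exists y, g y != 1].
Proof.
move=> ab fxB.
have nBT : [set: gT]%SET \subset 'N(B).
  by apply: sub_abelian_norm; [exact: ab|exact: finset.subsetT].
have nB z : z \in 'N(B) by apply: (fintype.subsetP nBT); rewrite inE.
pose q : {multiplicative G -> coset_of B} := hom_of (coset_hom (fun x => nB (f x))).
have [R RP] := image_is_group q (is_subgroupT G).
have qR y : q y \in R by apply/RP; exists y.
have qC y z : q y * q z = q z * q y.
  by rewrite -!gmulfM /= !gmulfM (Ab_classP _).1.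
have abR : abelian R.
  by apply/centsP => _ /RP[y _ <-] _ /RP[z _ <-]; exact: qC.
have R1 : R :!=: 1%g.
  apply/negP => /eqP R1; have := qR x; rewrite R1 => /set1P qx.
  by case/negP: fxB; apply: coset_idr.
have [M /andP[MR nMR] pM] := sol_prime_factor_exists (abelian_sol abR) R1.
pose g0 : {multiplicative G -> coset_of M} :=
  hom_of (coset_hom (fun y => fintype.subsetP nMR _ (qR y))).
have [y z|y|rT [g [Vr gP]]] := @Abm_corestrict #|R : M| _ _ g0.
- by rewrite -!gmulfM /= !gmulfM (Ab_classP _).1.
- rewrite -card_quotient //; apply: expg_cardG.
  by apply: mem_quotient; exact: qR.
exists #|R : M|, rT, g; split=> // [y yB|].
  have qy : q y = 1 by exact: coset_id.
  rewrite -(hom1 g); apply/gP; have -> : g0 y = coset M (q y) by [].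
  by rewrite qy hom1; exact: coset_id (group1 M).
apply: contrapT => g1; suff RM : R \subset M.
  by move: pM; rewrite (eqP (_ : #|R : M| == 1%N)) ?indexg_eq1.
apply/fintype.subsetP => _ /RP[y _ <-].
apply: coset_idr; first exact: (fintype.subsetP nMR).
have -> : coset M (q y) = g0 y by [].
rewrite -(hom1 g0); apply/gP; rewrite hom1.
by apply: contrapT => gy; apply: g1; exists y; apply/eqP.
Qed.

(** * Reduction from Ab to prime powers *)

Section Decomposition.
Variables (G : groupType) (H : set G).
Hypothesis sH : is_subgroup H.

Lemma pro_dense_AbP : pro_dense Ab H <-> forall p, prime p -> pro_dense (Abm p) H.
Proof.
split=> [/pro_denseP dH p _|dH].
  by apply/pro_denseP => x; apply: pro_closure_sub (dH x) => gT [].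
apply/pro_denseP => x; apply/pro_closureP => gT f ab.
have [B BP] := image_is_group f sH.
case: (boolP (f x \in B)) => [/BP//|fx].
have [p [rT [g [p_pr Vr gB [y /eqP[]]]]]] := prime_separation ab fx.
have /pro_denseP/(_ y)/pro_closureP/(_ rT g Vr)[h Hh <-] := dH p p_pr.
by apply: gB; apply/BP; exists h.
Qed.

Lemma pro_closure_AbE : pro_closure Ab H =
  \bigcap_(p in [set p : nat | prime p]) \bigcap_(k in [set k : nat | (0 < k)%N])
    pro_closure (Abm (p ^ k)) H.
Proof.
apply/seteqP; split=> x.
  by move=> cH p _ k _; apply: pro_closure_sub cH => gT [].
move=> cH; apply/pro_closureP => gT f ab.
have [B BP] := image_is_group f sH.
case: (boolP (f x \in B)) => [/BP//|fx].
have gT1 (y : gT) : y ^+ #|[set: gT]%SET| = 1.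
  by apply: expg_cardG; rewrite inE.
have [p pN fxc] := primary_separation ab (cardG_gt0 _) (gT1 (f x)) fx.
move: pN; rewrite -logn_gt0 => /[dup] k_gt0; rewrite logn_gt0 => pN.
have p_pr : prime p by move: pN; rewrite mem_primes => /andP[].
set N := #|_| in gT1 fxc k_gt0.
have [y|rT [g [Vr gP]]] := @Abm_power_hom _ _ f N`_p^'%N (p ^ logn p N) ab.
  by rewrite -p_part mulnC partnC ?cardG_gt0.
have /pro_closureP/(_ rT g Vr)[h Hh /gP e] := cH p p_pr _ k_gt0.
by case/negP: fxc; rewrite -e groupX //; apply/BP; exists h.
Qed.

(** If H contains the kernel of f and N is a multiple of the order of the
target, the subgroup attached to a prime p dividing N consists of the x for
which the power of f x with exponent the p'-part of N falls in the image of
H. *)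
Lemma pro_clopen_Ab_bigcap : pro_clopen Ab H <->
  exists (r : nat) (p k : 'I_r -> nat) (K : 'I_r -> set G),
    [/\ (1 <= r)%N, forall i, prime (p i), forall i, (0 < k i)%N,
        forall i, is_subgroup (K i) /\ pro_clopen (Abm (p i ^ k i)) (K i)
      & H = \bigcap_(i in [set: 'I_r]) K i].
Proof.
split=> [/pro_clopen_subgroupP[] // gT [f [ab fH]]|].
  have gC := (Ab_classP _).1 ab.
  (* The factor 2 gives N a prime divisor even when gT is trivial. *)
  pose N := (2 * #|[set: gT]%SET|)%N.
  have N_gt0 : (0 < N)%N by rewrite muln_gt0 cardG_gt0.
  have gN (y : gT) : y ^+ N = 1.
    by rewrite /N mulnC expgM expg_cardG ?expg1n // inE.
  pose ps := primes N; pose p (i : 'I_(size ps)) := nth 0%N ps i.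
  have p_ps i : p i \in ps by apply: mem_nth.
  have p_pr i : prime (p i) by have := p_ps i; rewrite mem_primes => /andP[].
  have [B BP] := image_is_group f sH.
  pose K i : set G := [set x | f x ^+ N`_(p i)^'%N \in B].
  have sK i : is_subgroup (K i).
    split=> [|x y|x]; rewrite /K /=; first by rewrite hom1 expg1n; exact: (group1 B).
      move=> xB yB; rewrite gmulfM expgMn; last exact: gC.
      exact: groupM xB yB.
    by rewrite homV expgVn groupV.
  exists (size ps), p, (fun i => logn (p i) N), K; split=> // [|i|i|].
  - have : 2 \in ps by rewrite mem_primes N_gt0 dvdn_mulr.
    by case: (ps).
  - by rewrite logn_gt0.
  - split=> //; apply/pro_clopen_subgroupP => //.
    have [y|rT [g [Vr gP]]] :=
      @Abm_power_hom _ _ f N`_(p i)^'%N (p i ^ logn (p i) N) ab.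
      by rewrite -p_part mulnC partnC.
    exists rT, g; split=> // x gx; rewrite /K /=.
    have /gP -> : g x = g 1 by rewrite gx hom1.
    by rewrite hom1 expg1n; exact: (group1 B).
  - apply/seteqP; split=> x.
      by move=> Hx i _; apply: groupX; apply/BP; exists x.
    move=> Kx; have [/BP[h Hh e]|fx] := boolP (f x \in B).
      case: sH => _ HM _; rewrite -(mulVKg h x); apply: HM => //; apply: fH.
      by rewrite gmulfM homV e mulVg.
    have [q q_ps] := primary_separation ab N_gt0 (gN _) fx.
    have iq : (index q ps < size ps)%N by rewrite index_mem.
    have := Kx (Ordinal iq) I; rewrite /K /p /= nth_index //.
    by move=> ->.
case=> r [p [k [K [_ _ _ cK HE]]]].
have {}cK (i : 'I_r) : exists h : {gT : finGroupType & {multiplicative G -> gT}},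
    Ab (tag h) /\ forall x, tagged h x = 1 -> K i x.
  have [sK /pro_clopen_subgroupP[] // gT [f [[ab _] fK]]] := cK i.
  by exists (existT (fun gT : finGroupType => {multiplicative G -> gT}) gT f).
case/choice: cK => h hP.
have [rT [g [Vr gP]]] := joint_hom (fun i => tagged (h i)) (fun i => (hP i).1).
apply/pro_clopen_subgroupP => //; exists rT, g; split=> // x gx.
rewrite HE => i _; apply: (hP i).2; rewrite -(hom1 (tagged (h i))).
by apply: gP; rewrite gx hom1.
Qed.

End Decomposition.

(** * Generated subgroups and congruence modulo commutators *)

Section GeneratedSubgroup.
Variable G : groupType.
Implicit Types S H : set G.

Lemma sub_generated S : S `<=` Defs.generated S.
Proof. by move=> x Sx H [_ SH]; exact: SH. Qed.

Lemma generated_sub S H : is_subgroup H -> S `<=` H -> Defs.generated S `<=` H.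
Proof. by move=> sH SH x; apply. Qed.

Lemma generated_subgroup S : is_subgroup (Defs.generated S).
Proof.
split=> [H [[]]//|x y Sx Sy H HP|x Sx H HP].
  by case: (HP) => -[_ HM _ _]; apply: HM; [exact: Sx|exact: Sy].
by case: (HP) => -[_ _ HV _]; apply: HV; exact: Sx.
Qed.

End GeneratedSubgroup.

Section ModuloCommutators.
Variables (G : groupType) (N : set G).
Hypotheses (sN : is_subgroup N) (N_comm : forall x y : G, N [~ x, y]).

Definition congr_mod (x y : G) : Prop := N (x * y^-1).

Lemma conj_closed x y : N x -> N (x ^ y).
Proof.
by case: sN => _ NM _ Nx; rewrite -(mulVKg x (x ^ y)); apply: NM => //; exact: N_comm.
Qed.

Lemma congr_mod_refl x : congr_mod x x.
Proof. by rewrite /congr_mod mulgV; case: sN. Qed.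

Lemma congr_mod_trans y x z : congr_mod x y -> congr_mod y z -> congr_mod x z.
Proof.
by case: sN => _ NM _ xy yz; have := NM _ _ xy yz; rewrite mulgA mulgVK.
Qed.

(** N contains all commutators, so it is normal, and right congruence modulo N
is compatible with products. *)
Lemma congr_modM x y u v :
  congr_mod x y -> congr_mod u v -> congr_mod (x * u) (y * v).
Proof.
case: sN => _ NM _ xy uv; have := NM _ _ (conj_closed x^-1 uv) xy.
by rewrite /congr_mod /conjg invgK invMg !mulgA mulgKV.
Qed.

Lemma congr_modC x y : congr_mod (x * y) (y * x).
Proof.
have := N_comm x^-1 y^-1.
by rewrite /congr_mod /commg /conjg !invgK invMg !mulgA.
Qed.

Lemma prod_expD (I : Type) (s : seq I) (g : I -> G) (n1 n2 : I -> nat) :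
  congr_mod ((\prod_(a <- s) g a ^+ n1 a) * (\prod_(a <- s) g a ^+ n2 a))
            (\prod_(a <- s) g a ^+ (n1 a + n2 a)%N).
Proof.
elim: s => [|a s IH]; first by rewrite !big_nil mulg1; exact: congr_mod_refl.
rewrite !big_cons expgnDr -!mulgA; apply: congr_modM; first exact: congr_mod_refl.
apply: congr_mod_trans (congr_modM (congr_mod_refl _) IH).
rewrite !mulgA; apply: congr_modM (congr_mod_refl _).
exact: congr_modC.
Qed.

(** Since N is normal, N P is closed under products and inverses; this applies
to F' F^m, with N the derived subgroup. *)
Lemma mulset_subgroup (P : set G) : is_subgroup P -> is_subgroup (mulset N P).
Proof.
case: sN => N1 NM NV [P1 PM PV]; split.
- by exists 1 => //; exists 1; rewrite ?mulg1.
- move=> _ _ [d Nd [u Pu <-]] [e Ne [v Pv <-]].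
  exists (d * e ^ u^-1); first by apply: NM => //; exact: conj_closed.
  exists (u * v); first exact: PM.
  by rewrite /conjg invgK !mulgA mulgKV.
- move=> _ [d Nd [u Pu <-]].
  exists ((d ^ u)^-1); first by apply/NV/conj_closed.
  exists u^-1; first exact: PV.
  by rewrite -invMg /conjg mulVKg.
Qed.

End ModuloCommutators.

(** * Exponent sums modulo m *)

Section FreeExponents.
Variables (A : Type) (m : nat).
Implicit Types (a : {classic A}) (x : letter A) (w : seq (letter A)).

(** An inverse letter counts m - 1 instead of -1, so that exponent sums are
natural numbers, usable as exponents; they are meaningful modulo m. *)
Definition weight a x : nat :=
  if x.1 == a then (if x.2 then m.-1 else 1%N) else 0%N.

Definition exponent_sum a w : nat := (\sum_(x <- w) weight a x)%N.

Hypothesis m_gt1 : (1 < m)%N.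

Lemma weight_inv a x : (weight a x + weight a (inv_letter x) = 0 %[mod m])%N.
Proof.
rewrite /weight /=; case: (x.1 == a) => //.
by case: x.2; rewrite /= ?addn1 ?add1n prednK ?modnn ?mod0n // ltnW.
Qed.

Lemma exponent_sum_push a x w :
  (exponent_sum a (push x w) = weight a x + exponent_sum a w %[mod m])%N.
Proof.
case: w => [|y w]; rewrite /exponent_sum /= ?big_cons ?big_nil //.
case: eqVneq => [->|_]; last by rewrite !big_cons.
by rewrite addnA -[RHS]modnDml weight_inv mod0n.
Qed.

Lemma exponent_sum_reduce a w :
  (exponent_sum a (reduce w) = exponent_sum a w %[mod m])%N.
Proof.
elim: w => //= x w IH; rewrite exponent_sum_push -modnDmr IH modnDmr.
by rewrite /exponent_sum big_cons.
Qed.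

Definition exponent_residue a (u : free_group A) : 'Z_m :=
  inZp (exponent_sum a (val u)).

Lemma exponent_residueM a : {morph exponent_residue a : u v / u * v}.
Proof.
move=> u v; apply: val_inj; rewrite /= (Zp_cast m_gt1) exponent_sum_reduce.
by rewrite /exponent_sum big_cat /= modnDm.
Qed.

Lemma Abm_Zp : Abm m 'Z_m.
Proof.
split; first exact: FinRing.zmod_abelian.
apply/exponent_setT_dvdn => z; rewrite Zp_expg; apply: val_inj => /=.
by rewrite [X in (_ %% X)%N](Zp_cast m_gt1) modnMl.
Qed.

Definition letter_elt x : free_group A := exist _ [:: x] isT.

Lemma prod_letter_elt (u : free_group A) : \prod_(x <- val u) letter_elt x = u.
Proof.
apply: val_inj; rewrite -[RHS](reduce_id (valP u)); elim: (val u) => [|x w IH].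
  by rewrite big_nil.
rewrite big_cons /=.
transitivity (reduce (x :: val (\prod_(x <- w) letter_elt x))) => //.
by rewrite IH /= (reduce_id (reduce_reduced w)).
Qed.

Variable N : set (free_group A).
Hypotheses (sN : is_subgroup N) (N_comm : forall u v : free_group A, N [~ u, v]).
Hypothesis N_pow : forall u : free_group A, N (u ^+ m).

Let gen a : free_group A := letter_elt (a, false).

(** The quotient by N is abelian of exponent dividing m, so equal letters of a
word can be gathered there and inverse letters replaced by powers with
exponent m - 1. *)
Lemma prod_exponent_sum (s : seq {classic A}) w : uniq s ->
  {in w, forall x, x.1 \in s} ->
  congr_mod N (\prod_(x <- w) letter_elt x)
              (\prod_(a <- s) gen a ^+ exponent_sum a w).
Proof.
move=> us; elim: w => [|x w IH] ws.
  rewrite big_nil big1 => [|a _]; first exact: congr_mod_refl.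
  by rewrite /exponent_sum big_nil.
rewrite big_cons (eq_bigr (fun a => gen a ^+ (weight a x + exponent_sum a w)%N));
  last by move=> a _; rewrite /exponent_sum big_cons.
apply: congr_mod_trans (prod_expD sN N_comm _ _ _ _) => //.
apply: congr_modM => //; last first.
  by apply: IH => y yw; apply: ws; rewrite inE yw orbT.
have xs : x.1 \in s by apply: ws; rewrite inE eqxx.
have -> : \prod_(a <- s) gen a ^+ weight a x =
    gen x.1 ^+ (if x.2 then m.-1 else 1%N).
  elim: s us xs {IH ws} => //= b s IH /andP[bs us].
  rewrite inE big_cons {1}/weight; case: eqVneq => [xb _|_ /= /(IH us) ->].
    rewrite xb big1_seq ?mulg1 // => a as_; rewrite /weight xb.
    by case: eqVneq as_ => // <-; rewrite (negbTE bs).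
  by rewrite mul1g.
case: x {xs ws} => a [] /=; last exact: congr_mod_refl.
have -> : letter_elt (a, true) = (gen a)^-1 by exact: val_inj.
rewrite /congr_mod -invMg -expgSr prednK ?(ltnW m_gt1) //.
by case: sN => _ _; apply.
Qed.

Lemma exponent_residue_mem (s : seq {classic A}) (u : free_group A) : uniq s ->
  {in val u, forall x, x.1 \in s} -> (forall a, a \in s -> exponent_residue a u = 1) ->
  N u.
Proof.
move=> us u_s u0; have := prod_exponent_sum us u_s; rewrite prod_letter_elt => Nu.
case: (sN) => N1 NM _.
rewrite -(mulgVK (\prod_(a <- s) gen a ^+ exponent_sum a (val u)) u).
apply: (NM) => //; rewrite big_seq; apply: (big_ind N) => [|v w|a /u0/(congr1 val)/=]; [exact: N1|exact: NM|].
rewrite (Zp_cast m_gt1) => /eqP/dvdnP[q ->].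
by rewrite expgM; exact: N_pow.
Qed.

End FreeExponents.

(** * The closure for abelian groups of exponent dividing m *)

Section ClosureAbm.
Variables (A : Type) (m : nat) (H : set (free_group A)).
Hypotheses (m_gt1 : (1 < m)%N) (sH : is_subgroup H) (fgH : finitely_generated H).

Definition letters_in (s : seq {classic A}) : set (free_group A) :=
  [set u | {in val u, forall x, x.1 \in s}].

Lemma reduce_subset (w : seq (letter A)) : {subset reduce w <= w}.
Proof.
elim: w => //= x w IH y.
have : y \in push x (reduce w) -> y \in x :: reduce w.
  case: (reduce w) => //= z w'; case: ifP => // _ yw.
  by rewrite !inE yw !orbT.
by move=> /[apply]; rewrite !inE => /orP[->//|/IH ->]; rewrite orbT.
Qed.

Lemma letters_in_subgroup s : is_subgroup (letters_in s).
Proof.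
split=> [//|u v us vs x /reduce_subset|u us x].
  by rewrite mem_cat => /orP[/us|/vs].
by rewrite mem_rev => /mapP[y /us ys ->].
Qed.

(** This is where finite generation enters: finitely many exponent sums then
suffice to separate x from H. *)
Lemma finite_support (x : free_group A) :
  exists s, [/\ uniq s, letters_in s x & H `<=` letters_in s].
Proof.
have [t HE] := fgH.
pose s := undup (flatten [seq [seq y.1 | y <- val u] | u <- x :: t]).
have us u : u \in x :: t -> letters_in s u.
  move=> ut y yu; rewrite mem_undup; apply/flattenP.
  by exists [seq y.1 | y <- val u]; apply/mapP; [exists u|exists y].
exists s; split; first exact: undup_uniq.
  by apply: us; rewrite inE eqxx.
rewrite HE; apply: generated_sub; first exact: letters_in_subgroup.
by move=> u ut; apply: us; rewrite inE [u \in t]ut orbT.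
Qed.

(** The closure contains H F' F^m because homomorphisms to Ab(m) kill F' and
F^m; conversely, joint exponent sums provide h in H with h^-1 x in F' F^m. *)
Lemma pro_closure_AbmE : pro_closure (Abm m) H =
  mulset (mulset H (derived_subgroup (free_group A)))
         (power_subgroup (free_group A) m).
Proof.
apply/seteqP; split=> [x /pro_closureP cH|_ [_ [h Hh [d Dd <-]] [u Pu <-]]].
  have [s [us xs Hs]] := finite_support x.
  pose f (i : 'I_(size s)) : {multiplicative free_group A -> 'Z_m} :=
    hom_of (exponent_residueM m_gt1 (tnth (in_tuple s) i)).
  have [rT [g [Vr gP]]] := joint_hom f (fun=> Abm_Zp m_gt1).
  have [h Hh ghx] := cH rT g Vr.
  pose N := mulset (derived_subgroup (free_group A)) (power_subgroup (free_group A) m).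
  have D_comm (u v : free_group A) : derived_subgroup (free_group A) [~ u, v].
    by apply: sub_generated; exists u, v.
  have sD : is_subgroup (derived_subgroup (free_group A)) by exact: generated_subgroup.
  have sP : is_subgroup (power_subgroup (free_group A) m) by exact: generated_subgroup.
  have : N (h^-1 * x).
    apply: (exponent_residue_mem m_gt1 _ _ _ us).
    - exact: mulset_subgroup.
    - move=> u v; exists [~ u, v] => //; exists 1; rewrite ?mulg1 //.
      by case: sP.
    - move=> u; exists 1; first by case: sD.
      by exists (u ^+ m); rewrite ?mul1g //; apply: sub_generated; exists u.
    - have [_ LM LV] := letters_in_subgroup s.
      by apply: LM => //; apply/LV/Hs.
    move=> a /(nthP a)[i i_s <-].
    have := gP _ _ ghx (Ordinal i_s); rewrite /f /= (tnth_nth a) /= => e.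
    pose E := hom_of (exponent_residueM m_gt1 (nth a s i)).
    have -> : exponent_residue m (nth a s i) (h^-1 * x) = E (h^-1 * x) by [].
    by rewrite gmulfM homV /= e mulVg.
  case=> d Dd [u Pu du]; exists (h * d); first by exists h => //; exists d.
  by exists u => //; rewrite -mulgA du mulVKg.
apply/pro_closureP => gT f [/Ab_classP gC /exponent_setT_dvdn gm].
exists h => //; have ker1 : is_subgroup [set v | f v = 1].
  split=> [|v w|v] /=; first exact: hom1.
    by move=> fv fw; rewrite gmulfM fv fw mulg1.
  by move=> fv; rewrite homV fv invg1.
have fd : f d = 1.
  apply: (generated_sub ker1 _ Dd) => _ [v [w ->]] /=.
  by rewrite /commg /conjg !gmulfM !homV (gC (f v) (f w)) mulKg mulVg.
have fu : f u = 1.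
  by apply: (generated_sub ker1 _ Pu) => _ [v _ <-] /=; rewrite homX gm.
by rewrite !gmulfM fd fu !mulg1.
Qed.

End ClosureAbm.

(** * The theorem *)

Theorem proposition5p2 (A : Type) (H : set (free_group A))
    (H_subgroup : is_subgroup H) (H_fg : finitely_generated H) :
  [/\ pro_clopen Ab H <->
      (exists (r : nat) (p k : 'I_r -> nat) (K : 'I_r -> set (free_group A)),
        [/\ (1 <= r)%N,
            forall i, prime (p i),
            forall i, (0 < k i)%N,
            forall i, is_subgroup (K i) /\ pro_clopen (Abm (p i ^ k i)) (K i)
          & H = \bigcap_(i in [set: 'I_r]) K i]),
      pro_dense Ab H <-> (forall p : nat, prime p -> pro_dense (Abm p) H)
    & pro_closure Ab H =
        \bigcap_(p in [set p : nat | prime p]) \bigcap_(k in [set k : nat | (0 < k)%N])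
          pro_closure (Abm (p ^ k)) H /\
      \bigcap_(p in [set p : nat | prime p]) \bigcap_(k in [set k : nat | (0 < k)%N])
          pro_closure (Abm (p ^ k)) H =
        \bigcap_(p in [set p : nat | prime p]) \bigcap_(k in [set k : nat | (0 < k)%N])
          mulset (mulset H (derived_subgroup (free_group A)))
                 (power_subgroup (free_group A) (p ^ k))].
Proof.
split; [exact: pro_clopen_Ab_bigcap | exact: pro_dense_AbP | split].
  exact: pro_closure_AbE.
apply: eq_bigcapr => p p_pr; apply: eq_bigcapr => k k_gt0.
by rewrite pro_closure_AbmE // -(exp1n k) ltn_exp2r // prime_gt1.
Qed.
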